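(* Let $G$ be a finite group and $H$ a normal subgroup of $G$. Say that $H$ satisfies property (P) if for every $g\in G$ with $g^2\in H$ there exists $h\in H$ such that $(gh)^2=e$. Then: (a) $H$ is a perfect code of $G$ if and only if $H$ satisfies (P). (b) $H$ is a total perfect code of $G$ if and only if $|H|$ is even and $H$ satisfies (P).
   Context: All groups and graphs are finite; $e$ denotes the identity of $G$. For $S\subseteq G$ with $e\notin S$ and $S^{-1}=S$, the Cayley graph $\mathrm{Cay}(G,S)$ has vertex set $G$, with $x,y$ adjacent iff $yx^{-1}\in S$. A subset $C$ of the vertex set of a graph is a perfect code if every vertex is at distance at most one from exactly one vertex of $C$; it is a total perfect code if every vertex has exactly one neighbour in $C$. A subset $C\subseteq G$ is called a perfect code (resp. total perfect code) of $G$ if it is a perfect code (resp. total perfect code) in some Cayley graph $\mathrm{Cay}(G,S)$ of $G$. *)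

(* Defs.v *)
From HB Require Import structures.
From mathcomp Require Import all_boot all_fingroup.

Set Implicit Arguments.
Unset Strict Implicit.
Unset Printing Implicit Defensive.

Import GroupScope.

Section Codes.

(* A graph is given by its vertex set V and its adjacency relation adj,
   where adj x y is meant to imply x \in V and y \in V. *)
Variables (T : finType) (V : {set T}) (adj : rel T).

(* Graph distance at most n: a walk from x to y with at most n edges. *)
Definition dist_le (n : nat) (x y : T) : Prop :=
  exists p : seq T, [/\ path adj x p, last x p = y & size p <= n].

Definition perfect_code (C : {set T}) : Prop :=
  C \subset V /\
  (forall v, v \in V -> exists! c, c \in C /\ dist_le 1 v c).

Definition total_perfect_code (C : {set T}) : Prop :=
  C \subset V /\
  (forall v, v \in V -> exists! c, c \in C /\ adj v c).

End Codes.

Section Cayley.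

Variables (gT : finGroupType) (G : {group gT}).

(* S^-1 is the pointwise inverse of the set S. *)
Definition connection_set (S : {set gT}) : Prop :=
  [/\ S \subset G, 1 \notin S & S^-1 = S].

Definition cayley_adj (S : {set gT}) : rel gT :=
  fun x y => [&& x \in G, y \in G & y * x^-1 \in S].

Definition perfect_code_of (C : {set gT}) : Prop :=
  exists2 S, connection_set S & perfect_code G (cayley_adj S) C.

Definition total_perfect_code_of (C : {set gT}) : Prop :=
  exists2 S, connection_set S & total_perfect_code G (cayley_adj S) C.

Definition property_P (H : {set gT}) : Prop :=
  forall g, g \in G -> g ^+ 2 \in H -> exists2 h, h \in H & (g * h) ^+ 2 = 1.

End Cayley.

(* Main.v *)
Require Import Defs.
From mathcomp Require Import all_boot all_fingroup all_solvable.

Import GroupScope.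

(** The neighbours of [v] in [Cay(G, S)] are the elements of [S v], so [H] is a
perfect (resp. total perfect) code exactly when [1 |: S] (resp. [S]) meets every
right coset of [H] in exactly one point. If an inverse-closed set is such a
transversal and [g ^+ 2 \in H], then the coset of [g] is its own inverse, so its
representative is an involution or [1]: this is (P). Conversely, (P) lets one
choose representatives compatibly with inversion, an arbitrary [t0 \in H] with
[t0^-1 = t0] representing [H] itself: [t0 = 1] for perfect codes, and an
involution of [H] for total perfect codes. *)

(** As [c] runs over [H], [c * v^-1] runs over [H :* v^-1], and [v^-1] over all of [G]. *)
Definition coset_exact {gT : finGroupType} (G H U : {set gT}) : Prop :=
  forall v, v \in G -> exists! c, c \in H /\ c * v^-1 \in U.

Section CosetExact.

Context {gT : finGroupType} {G H : {group gT}}.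

Lemma ex_unique_iff (T : Type) (P Q : T -> Prop) :
  (forall c, P c <-> Q c) -> (exists! c, P c) <-> (exists! c, Q c).
Proof.
move=> PQ; split=> -[c [/PQ cP cU]]; exists c; split=> // c' /PQ; exact: cU.
Qed.

Lemma total_perfect_code_exact (S : {set gT}) : H \subset G ->
  total_perfect_code G (cayley_adj G S) H <-> coset_exact G H S.
Proof.
move=> sHG; have adjE v c : v \in G ->
    c \in H /\ cayley_adj G S v c <-> c \in H /\ c * v^-1 \in S.
  move=> Gv; rewrite /cayley_adj Gv /=.
  by split=> -[Hc]; rewrite (subsetP sHG _ Hc).
split=> [[_ codeH] | exactS]; last split=> //.
  by move=> v Gv; apply/(ex_unique_iff _ _ _ (fun c => adjE v c Gv)); apply: codeH.
by move=> v Gv; apply/(ex_unique_iff _ _ _ (fun c => adjE v c Gv)); apply: exactS.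
Qed.

Lemma dist_le1P (T : finType) (adj : rel T) (x y : T) :
  dist_le adj 1 x y <-> x = y \/ adj x y.
Proof.
split=> [[[|z [|z' p]] [] //= ep ez _] | [-> | exy]].
- by left.
- by right; rewrite -ez; case/andP: ep.
- by exists [::].
- by exists [:: y]; split=> //=; rewrite exy.
Qed.

Lemma perfect_code_exact (S : {set gT}) : H \subset G ->
  perfect_code G (cayley_adj G S) H <-> coset_exact G H (1 |: S).
Proof.
move=> sHG; have adjE v c : v \in G ->
    c \in H /\ dist_le (cayley_adj G S) 1 v c <->
    c \in H /\ c * v^-1 \in 1 |: S.
  move=> Gv; rewrite !inE -eq_mulgV1; split=> -[Hc].
    by move/dist_le1P=> [-> | /and3P[_ _ ->]]; rewrite ?eqxx ?orbT; split.
  move=> cS; split=> //; apply/dist_le1P.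
  case/orP: cS => [/eqP-> | cS]; [by left | right].
  by rewrite /cayley_adj Gv (subsetP sHG _ Hc).
split=> [[_ codeH] | exactS]; last split=> //.
  by move=> v Gv; apply/(ex_unique_iff _ _ _ (fun c => adjE v c Gv)); apply: codeH.
by move=> v Gv; apply/(ex_unique_iff _ _ _ (fun c => adjE v c Gv)); apply: exactS.
Qed.

Lemma coset_exact_property_P (U : {set gT}) :
  H <| G -> U^-1 = U -> coset_exact G H U -> property_P G H.
Proof.
move=> nHG invU exactU g Gg Hg2.
have [c [[Hc Uc] uniq_c]] := exactU g Gg.
(* The inverse of [c * g^-1] is [(g * c^-1 * g) * g^-1], again in [U]. Normality and [g ^+ 2 \in H]
   put [g * c^-1 * g] in [H], so uniqueness applies. *)
have eq_c : c = g * c^-1 * g.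
  apply: uniq_c; split; last by rewrite mulgK -invU inE invMg invgK.
  have -> : g * c^-1 * g = (c^-1) ^ g^-1 * g ^+ 2.
    by rewrite conjgE invgK expgS expg1 !mulgA mulgKV.
  by rewrite groupM // memJ_norm ?groupV // (subsetP (normal_norm nHG)).
exists c^-1; rewrite ?groupV //.
by rewrite expgS expg1 mulgA -eq_c mulgV.
Qed.

(** Inversion splits the family into orbits of size one or two. A self-inverse set needs a
    self-inverse element; in a pair, one choice dictates the other. *)
Lemma inverse_equivariant_choice (P : pred {set gT}) :
    (forall A, P A -> P A^-1) ->
    (forall A, P A -> A != set0) ->
    (forall A, P A -> A^-1 = A -> exists2 t, t \in A & t^-1 = t) ->
  exists r : {set gT} -> gT,
    forall A, P A -> r A \in A /\ r A^-1 = (r A)^-1.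
Proof.
move=> PV Pn0 Pinv.
pose fixed (A : {set gT}) := odflt 1 [pick t in A | t^-1 == t].
pose free (A : {set gT}) := odflt 1 [pick t in A].
(* The rank decides which member of a pair is chosen from freely. On the family, the default [1] of
   [odflt] is never reached. *)
pose r (A : {set gT}) := if A^-1 == A then fixed A else
  if enum_rank A < enum_rank A^-1 then free A else (free A^-1)^-1.
have free_in A : P A -> free A \in A.
  rewrite /free => /Pn0/set0Pn[x Ax].
  by case: pickP => [//|/(_ x)]; rewrite Ax.
exists r => A PA; rewrite /r invgK (eq_sym A).
case: eqP => [eqA | /eqP neqA].
  rewrite eqA /fixed; have [t At tV] := Pinv A PA eqA.
  case: pickP => [s /andP[As /eqP sV] | /(_ t)]; last by rewrite At tV eqxx.
  by rewrite /= sV.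
case: ltngtP => [_ | _ | /ord_inj/enum_rank_inj eqA].
- by rewrite free_in.
- by rewrite invgK -mem_invg free_in ?PV.
- by rewrite -eqA eqxx in neqA.
Qed.

Lemma property_P_coset_exact (t0 : gT) :
    H <| G -> property_P G H -> t0 \in H -> t0^-1 = t0 ->
  exists T : {set gT},
    [/\ T \subset G, T^-1 = T, T :&: H = [set t0] & coset_exact G H T].
Proof.
move=> nHG propP Ht0 t0V; have sHG := normal_sub nHG.
have rcosV x : x \in G -> (H :* x)^-1 = H :* x^-1.
  by move=> Gx; rewrite invg_rcoset norm_rlcoset
    ?groupV ?(subsetP (normal_norm nHG)).
(* Intersecting with [Q] cuts [H] down to [[set t0]] and leaves every other coset whole, so the
   choice on [H] is forced. *)
pose Q := [set t | (t \in H) ==> (t == t0)].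
have QV : Q^-1 = Q.
  apply/setP=> t; rewrite !inE groupV; congr (_ ==> _).
  by rewrite -{1}t0V (inj_eq invg_inj).
pose B (x : gT) := (H :* x) :&: Q.
have BV x : x \in G -> (B x)^-1 = B x^-1.
  by move=> Gx; rewrite /B -rcosV // -{2}QV; apply/setP=> t; rewrite !inE.
pose P (A : {set gT}) := [exists x, (x \in G) && (A == B x)].
have PB x : x \in G -> P (B x) by move=> Gx; apply/existsP; exists x; rewrite Gx /=.
have [||| r rP] := inverse_equivariant_choice P.
- move=> _ /existsP[x /andP[Gx /eqP->]].
  by rewrite BV // PB ?groupV.
- move=> _ /existsP[x /andP[Gx /eqP->]]; apply/set0Pn.
  have [Hx | nHx] := boolP (x \in H).
    by exists t0; rewrite !inE eqxx implybT mem_rcoset groupMl ?groupV ?Hx.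
  by exists x; rewrite !inE rcoset_refl (negPf nHx).
- move=> _ /existsP[x /andP[Gx /eqP->]]; rewrite BV // => eqB.
  have [Hx | nHx] := boolP (x \in H).
    by exists t0; rewrite ?t0V // !inE eqxx implybT mem_rcoset groupMl ?groupV ?Hx.
  (* A self-inverse coset [H :* x] gives [x * x \in H], and (P) then supplies a self-inverse [x * h]
     in it. *)
  have : x \in B x^-1 by rewrite eqB !inE rcoset_refl (negPf nHx).
  rewrite 2!inE mem_rcoset invgK => /andP[Hx2 _].
  have [h Hh xh2] := propP x Gx Hx2.
  have xhH : x * h \in H :* x.
    by rewrite norm_rlcoset ?(subsetP (normal_norm nHG)) // mem_lcoset mulKg.
  exists (x * h); first by rewrite !inE xhH groupMr // (negPf nHx).
  by apply/eqP; rewrite eq_invg_mul; apply/eqP.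
have rB x : x \in G -> r (B x) \in B x by move=> Gx; have [] := rP _ (PB x Gx).
have rBH x : x \in G -> r (B x) \in H :* x by move/rB; rewrite inE => /andP[].
pose T := [set r (B x) | x in G].
have TV t : t \in T -> t^-1 \in T.
  case/imsetP=> x Gx ->; have [_ <-] := rP _ (PB x Gx).
  by rewrite BV // imset_f ?groupV.
have TQ t : t \in T -> t \in H -> t = t0.
  case/imsetP=> x Gx -> rH; have := rB x Gx.
  by rewrite !inE rH => /andP[_ /eqP].
exists T; split.
- apply/subsetP=> _ /imsetP[x Gx ->]; have := rBH x Gx.
  by rewrite mem_rcoset => /(subsetP sHG); rewrite groupMr ?groupV.
- apply/setP=> t; rewrite inE; apply/idP/idP=> [/TV | /TV //].
  by rewrite invgK.
- have r1H : r (B 1) \in H by have := rBH 1 (group1 G); rewrite rcoset1.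
  have r1T : r (B 1) \in T by rewrite imset_f.
  apply/setP=> t; rewrite !inE; apply/andP/eqP=> [[tT tH] | ->]; first exact: TQ.
  by rewrite -(TQ _ r1T r1H).
move=> v Gv; have GvV : v^-1 \in G by rewrite groupV.
exists (r (B v^-1) * v); split.
  split; last by rewrite mulgK imset_f.
  by have := rBH _ GvV; rewrite mem_rcoset invgK.
move=> c [Hc /imsetP[y Gy def_c]].
have cy : c * v^-1 \in H :* y by rewrite def_c rBH.
have cv : c * v^-1 \in H :* v^-1 by rewrite mem_rcoset mulgK.
(* [r] sees only the coset, so equal cosets have the same representative. *)
have eqHyv : H :* y = H :* v^-1 by rewrite -(rcoset_eqP cy) (rcoset_eqP cv).
by rewrite -(mulgKV v c) def_c /B eqHyv.
Qed.

Lemma even_card_involution :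
  ~~ odd #|H| <-> exists2 t, t \in H & t != 1 /\ t^-1 = t.
Proof.
split=> [evenH | [t Ht [nt1 tV]]].
  have /(Cauchy (isT : prime 2))[t Ht ot] : 2 %| #|H| by rewrite dvdn2.
  exists t => //; rewrite -order_gt1 ot; split=> //.
  by apply/eqP; rewrite eq_invg_mul -expg2 -ot expg_order.
rewrite -dvdn2 -(nt_prime_order (isT : prime 2) _ nt1) ?order_dvdG //.
by rewrite expg2 -{1}tV mulVg.
Qed.

End CosetExact.

Theorem theorem2p2 (gT : finGroupType) (G H : {group gT}) (nHG : H <| G) :
  (perfect_code_of G H <-> property_P G H) /\
  (total_perfect_code_of G H <-> ~~ odd #|H| /\ property_P G H).
Proof.
have sHG := normal_sub nHG; split; split.
- case=> S [_ _ SV] /(perfect_code_exact _ sHG).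
  apply: coset_exact_property_P => //; apply/setP=> t.
  by rewrite !inE invg_eq1 -{1}SV inE invgK.
- move=> propP.
  have [T [sTG TV TH exT]] :=
    property_P_coset_exact 1 nHG propP (group1 H) (invg1 _).
  have T1 : 1 \in T by have := set11 (1 : gT); rewrite -TH inE => /andP[].
  (* With [t0 = 1], the identity lies in [T] and is removed to give a connection set. *)
  exists (T :\ 1); last by apply/(perfect_code_exact _ sHG); rewrite setD1K.
  split; rewrite ?setD11 ?(subset_trans (subD1set _ _)) //.
  by apply/setP=> t; rewrite !inE invg_eq1 -{1}TV inE invgK.
- case=> S [_ nS1 SV] /(total_perfect_code_exact _ sHG) exS.
  split; last exact: coset_exact_property_P exS.
  (* The only neighbour [c] of [1] in [H] equals [c^-1], which is another such neighbour; it is an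
     involution because [1 \notin S]. *)
  have [c [[Hc]]] := exS 1 (group1 G); rewrite invg1 mulg1 => Sc uniq_c.
  apply/even_card_involution; exists c => //; split.
    by apply: contraNneq nS1 => <-.
  symmetry; apply: uniq_c; rewrite groupV mulg1; split=> //.
  by rewrite -SV inE invgK.
- case=> /even_card_involution[t Ht [nt1 tV]] propP.
  have [T [sTG TV TH exT]] := property_P_coset_exact t nHG propP Ht tV.
  exists T; last exact/(total_perfect_code_exact _ sHG).
  (* [T] meets [H] only in [t], so [1 \in T] would force [t = 1]. *)
  split=> //; apply: contra nt1 => T1.
  by rewrite eq_sym -in_set1 -TH inE T1 group1.
Qed.
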